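(* Let $K=\mathbb{F}_2$ and let $S$ be a smooth cubic surface over $K$. Suppose $S$ contains a line $\ell$ defined over $K$ that contains no $K$-rational Eckardt points. Then there exists a point $P\in\ell(K)$ such that $\mathrm{Span}(P)=S(K)$.
   Context: A smooth cubic surface $S$ over $K$ is a nonsingular surface in $\mathbb{P}^3$ defined by a homogeneous cubic polynomial over $K$. A $K$-line is a line in $\mathbb{P}^3$ defined over $K$. A line ''on $S$'' means a line over $\overline{K}$ contained in $S$. An Eckardt point is a point of $S$ through which three of the lines on $S$ pass. For a line $\ell\not\subset S$, $\ell\cdot S=P+Q+R$ with multiplicity. For $B\subseteq S(K)$ define $B_0=B$ and $B_{n+1}$ as the set of $R\in S(K)$ such that either $R\in B_n$ or there exist $P,Q\in B_n$ and a $K$-line $\ell\not\subset S$ with $\ell\cdot S=P+Q+R$; $\mathrm{Span}(B)=\bigcup_n B_n$, and $\mathrm{Span}(P)=\mathrm{Span}(\{P\})$. *)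

(* Defs.v *)
From HB Require Import structures.
From mathcomp Require Import all_boot all_order all_algebra.
From mathcomp Require Import closed_field.
Set Implicit Arguments. Unset Strict Implicit. Unset Printing Implicit Defensive.
Import Order.TTheory GRing.Theory Num.Theory.
Local Open Scope ring_scope.

Notation F2 := 'F_2.

Definition Kbar_sig := countable_algebraic_closure F2.
Definition Kbar : countClosedFieldType := projT1 Kbar_sig.
Definition inj : {rmorphism F2 -> Kbar} := proj1_sig (projT2 Kbar_sig).

(* Points of P^3 are represented by nonzero row vectors of length 4.
   A homogeneous cubic form over F_2 in x_0..x_3 is given by a coefficient
   tensor c : F(x) = sum_{i,j,k} c i j k x_i x_j x_k (every cubic form arises). *)
Definition cubic := 'I_4 -> 'I_4 -> 'I_4 -> F2.

Definition cform (R : comNzRingType) (f : F2 -> R) (c : cubic) (x : 'rV[R]_4) : R :=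
  \sum_(i < 4) \sum_(j < 4) \sum_(k < 4) f (c i j k) * x 0 i * x 0 j * x 0 k.

Definition dcform (R : comNzRingType) (f : F2 -> R) (c : cubic) (l : 'I_4)
    (x : 'rV[R]_4) : R :=
  \sum_(i < 4) \sum_(j < 4) \sum_(k < 4) f (c i j k) *
     ((i == l)%:R * x 0 j * x 0 k + x 0 i * (j == l)%:R * x 0 k
      + x 0 i * x 0 j * (k == l)%:R).

Definition FK (c : cubic) (x : 'rV[Kbar]_4) : Kbar := cform inj c x.

Definition smooth (c : cubic) : Prop :=
  forall x : 'rV[Kbar]_4, x != 0 -> FK c x = 0 ->
    exists l : 'I_4, dcform inj c l x != 0.

(* S(K): the K-rational points of S (over F_2 a projective point is exactly
   a nonzero vector). *)
Definition SK (c : cubic) (P : 'rV[F2]_4) : Prop :=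
  P != 0 /\ cform id c P = 0.

Definition line_on_S (c : cubic) (M : 'M[Kbar]_(2, 4)) : Prop :=
  \rank M = 2%N /\ forall x : 'rV[Kbar]_4, (x <= M)%MS -> FK c x = 0.

Definition eckardt (c : cubic) (P : 'rV[Kbar]_4) : Prop :=
  P != 0 /\ FK c P = 0 /\
  exists M1 M2 M3 : 'M[Kbar]_(2, 4),
    [/\ line_on_S c M1, line_on_S c M2, line_on_S c M3,
        [/\ (P <= M1)%MS, (P <= M2)%MS & (P <= M3)%MS] &
        [/\ ~~ (M1 == M2)%MS, ~~ (M1 == M3)%MS & ~~ (M2 == M3)%MS]].

(* A K-line: row space of a rank-2 2x4 matrix L over F_2; its points over Kbar
   are parametrised by (s:t) |-> (s, t) *m L. *)
Definition kline_pt (L : 'M[F2]_(2, 4)) (s t : Kbar) : 'rV[Kbar]_4 :=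
  (\row_(i < 2) (if i == 0 then s else t)) *m map_mx inj L.

(* the linear form on P^1 vanishing at the parameter p = (p0 : p1) *)
Definition lform (p : 'rV[F2]_2) (s t : Kbar) : Kbar :=
  inj (p 0 1) * s - inj (p 0 0) * t.

(* l . S = P + Q + R (with multiplicity) for the K-line L not contained in S:
   the restriction of F to l is, up to a nonzero scalar, the product of the
   linear forms vanishing at P, Q, R. *)
Definition inter3 (c : cubic) (L : 'M[F2]_(2, 4)) (P Q R : 'rV[F2]_4) : Prop :=
  \rank L = 2%N /\
  ~ (forall s t : Kbar, FK c (kline_pt L s t) = 0) /\
  exists p q r : 'rV[F2]_2,
    [/\ p != 0, q != 0 & r != 0] /\ [/\ P = p *m L, Q = q *m L & R = r *m L] /\
    exists lam : Kbar, lam != 0 /\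
      forall s t : Kbar,
        FK c (kline_pt L s t) = lam * lform p s t * lform q s t * lform r s t.

Fixpoint Bn (c : cubic) (B : 'rV[F2]_4 -> Prop) (n : nat) : 'rV[F2]_4 -> Prop :=
  match n with
  | 0%N => B
  | n'.+1 => fun R => SK c R /\
      (Bn c B n' R \/ exists P Q (L : 'M[F2]_(2, 4)),
          [/\ Bn c B n' P, Bn c B n' Q & inter3 c L P Q R])
  end.

Definition Span (c : cubic) (B : 'rV[F2]_4 -> Prop) (R : 'rV[F2]_4) : Prop :=
  exists n, Bn c B n R.

Definition on_kline (L : 'M[F2]_(2, 4)) (P : 'rV[F2]_4) : Prop :=
  P != 0 /\ (P <= L)%MS.

(* Main.v *)
Require Import Defs.
From HB Require Import structures.
From mathcomp Require Import all_boot all_order all_algebra.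
From mathcomp Require Import closed_field.
From mathcomp Require Import ring.
Set Implicit Arguments. Unset Strict Implicit. Unset Printing Implicit Defensive.
Import GRing.Theory.
Local Open Scope ring_scope.

(* The trilinear form of F expands F on combinations of vectors through
   dF_x(y), the derivative of F at x in the direction y, and its polarization in x.
   In a basis whose first two vectors span l, sixteen bits of these determine F, as
   F(x) = dF_x(x) over F_2. Over F_2, a line through two points P, R of S(F_2) is
   tangent at P and meets S again in R exactly when dF_P(R) = 0 and dF_R(P) = 1,
   and meets S in P, P + R, R when dF_P(R) = dF_R(P) = 1; so the span of a point is
   computed from the sixteen bits. Three consequences of the hypotheses suffice and
   are again conditions on these bits: S is nonsingular at its F_2-points, S is
   nonsingular at the conjugate pair of F_4-points of l, and no tangent plane at a
   point P of l(F_2) cuts out three distinct lines through P. For each of the 2^16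
   values of the bits that satisfy them, the first or the second basis vector spans
   S(F_2), which is checked by computation. *)

(** * Polarization of cubic forms *)

Section Polarization.
Variables (R : comNzRingType) (f : F2 -> R) (c : cubic).
Implicit Types (x y z : 'rV[R]_4) (a b : R).

Definition trilin x y z : R :=
  \sum_(i < 4) \sum_(j < 4) \sum_(k < 4) f (c i j k) * x 0 i * y 0 j * z 0 k.

(** Linearity in each slot comes down to an identity between monomials; the six rules that follow
    are instances. *)
Let trilin_congr x y z x1 y1 z1 x2 y2 z2 a b :
  (forall i j k, x 0 i * y 0 j * z 0 k =
     a * (x1 0 i * y1 0 j * z1 0 k) + b * (x2 0 i * y2 0 j * z2 0 k)) ->
  trilin x y z = a * trilin x1 y1 z1 + b * trilin x2 y2 z2.
Proof.
move=> E; rewrite /trilin !mulr_sumr -big_split; apply: eq_bigr => i _ /=.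
rewrite !mulr_sumr -big_split; apply: eq_bigr => j _ /=.
rewrite !mulr_sumr -big_split; apply: eq_bigr => k _ /=.
by rewrite -!mulrA [x 0 i * _]mulrA E; ring.
Qed.

Lemma trilinDl x x' y z : trilin (x + x') y z = trilin x y z + trilin x' y z.
Proof.
by rewrite -[RHS]mul1r mulrDr; apply: trilin_congr => i j k; rewrite mxE; ring.
Qed.

Lemma trilinDm x y y' z : trilin x (y + y') z = trilin x y z + trilin x y' z.
Proof.
by rewrite -[RHS]mul1r mulrDr; apply: trilin_congr => i j k; rewrite mxE; ring.
Qed.

Lemma trilinDr x y z z' : trilin x y (z + z') = trilin x y z + trilin x y z'.
Proof.
by rewrite -[RHS]mul1r mulrDr; apply: trilin_congr => i j k; rewrite mxE; ring.
Qed.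

Lemma trilinZl a x y z : trilin (a *: x) y z = a * trilin x y z.
Proof.
rewrite -[RHS]addr0 -[0](mul0r (trilin x y z)).
by apply: trilin_congr => i j k; rewrite mxE; ring.
Qed.

Lemma trilinZm a x y z : trilin x (a *: y) z = a * trilin x y z.
Proof.
rewrite -[RHS]addr0 -[0](mul0r (trilin x y z)).
by apply: trilin_congr => i j k; rewrite mxE; ring.
Qed.

Lemma trilinZr a x y z : trilin x y (a *: z) = a * trilin x y z.
Proof.
rewrite -[RHS]addr0 -[0](mul0r (trilin x y z)).
by apply: trilin_congr => i j k; rewrite mxE; ring.
Qed.

Definition trilinE :=
  (trilinDl, trilinDm, trilinDr, trilinZl, trilinZm, trilinZr).

(** The tensor [c] need not be symmetric, so the direction [y] visits each of the three slots. *)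
Definition dform x y : R := trilin y x x + trilin x y x + trilin x x y.

Lemma dformE x y : dform x y = \sum_l y 0 l * dcform f c l x.
Proof.
rewrite /dcform; under eq_bigr => l _ do rewrite mulr_sumr.
rewrite [RHS]exchange_big /dform /trilin -!big_split; apply: eq_bigr => i _ /=.
under [RHS]eq_bigr => l _ do rewrite mulr_sumr.
rewrite [RHS]exchange_big -!big_split; apply: eq_bigr => j _ /=.
under [RHS]eq_bigr => l _ do rewrite mulr_sumr.
rewrite [RHS]exchange_big -!big_split; apply: eq_bigr => k _ /=.
(* Expanding the coordinates of [y] against Kronecker deltas puts both sides under one sum over
   [l]. *)
have pick (n : 'I_4) : y 0 n = \sum_(l < 4) y 0 l * (n == l)%:R.
  rewrite (bigD1 n) //= eqxx mulr1 big1 ?addr0 // => l /negPf nl.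
  by rewrite eq_sym nl mulr0.
rewrite (pick i) (pick j) (pick k) !(mulr_sumr, mulr_suml) -!big_split.
by apply: eq_bigr => l _ /=; ring.
Qed.

Lemma cform_pencil a b x y :
  cform f c (a *: x + b *: y) =
  a ^+ 3 * cform f c x + a ^+ 2 * b * dform x y
  + a * b ^+ 2 * dform y x + b ^+ 3 * cform f c y.
Proof.
change (trilin (a *: x + b *: y) (a *: x + b *: y) (a *: x + b *: y) =
  a ^+ 3 * trilin x x x + a ^+ 2 * b * dform x y
  + a * b ^+ 2 * dform y x + b ^+ 3 * trilin y y y).
by rewrite /dform !trilinE; ring.
Qed.

Lemma dform_linearr a x y y' :
  dform x (y + a *: y') = dform x y + a * dform x y'.
Proof. by rewrite /dform !trilinE; ring. Qed.

(** The polar form of the quadratic map [x |-> dform x y]. It is the sum over all placements of the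
    three vectors in the slots, hence symmetric. *)
Definition hessian x x' y : R := dform (x + x') y - dform x y - dform x' y.

Lemma dform_pencill a x x' y :
  dform (x + a *: x') y =
  dform x y + a * hessian x x' y + a ^+ 2 * dform x' y.
Proof. by rewrite /hessian /dform !trilinE; ring. Qed.

Lemma hessianC x x' y : hessian x x' y = hessian x y x'.
Proof. by rewrite /hessian /dform !trilinE; ring. Qed.

Lemma hessianCl x x' y : hessian x x' y = hessian x' x y.
Proof. by rewrite /hessian [x + x']addrC; ring. Qed.

Lemma hessian_diag x y : hessian x y x = dform x y *+ 2.
Proof. by rewrite /hessian /dform !trilinE; ring. Qed.

(** Euler's relation in degree 3. *)
Lemma dform_diag x : dform x x = cform f c x *+ 3.
Proof. by rewrite /dform -[cform _ _ _]/(trilin x x x); ring. Qed.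

Lemma dform_combl a0 a1 a2 a3 u0 u1 u2 u3 y :
  dform (a0 *: u0 + a1 *: u1 + a2 *: u2 + a3 *: u3) y =
  a0 ^+ 2 * dform u0 y + a1 ^+ 2 * dform u1 y
  + a2 ^+ 2 * dform u2 y + a3 ^+ 2 * dform u3 y
  + a0 * a1 * hessian u0 u1 y + a0 * a2 * hessian u0 u2 y
  + a0 * a3 * hessian u0 u3 y + a1 * a2 * hessian u1 u2 y
  + a1 * a3 * hessian u1 u3 y + a2 * a3 * hessian u2 u3 y.
Proof. by rewrite /hessian /dform !trilinE; ring. Qed.

Lemma dform_combr a0 a1 a2 a3 u0 u1 u2 u3 x :
  dform x (a0 *: u0 + a1 *: u1 + a2 *: u2 + a3 *: u3) =
  a0 * dform x u0 + a1 * dform x u1 + a2 * dform x u2 + a3 * dform x u3.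
Proof. by rewrite /dform !trilinE; ring. Qed.

End Polarization.

Lemma trilin_inj (c : cubic) (x y z : 'rV[F2]_4) :
  trilin inj c (map_mx inj x) (map_mx inj y) (map_mx inj z)
  = inj (trilin id c x y z).
Proof.
rewrite /trilin rmorph_sum; apply: eq_bigr => i _.
rewrite rmorph_sum; apply: eq_bigr => j _.
rewrite rmorph_sum; apply: eq_bigr => k _.
by rewrite !mxE !rmorphM.
Qed.

Lemma cform_inj (c : cubic) (x : 'rV[F2]_4) :
  cform inj c (map_mx inj x) = inj (cform id c x).
Proof. exact: trilin_inj. Qed.

Lemma dform_inj (c : cubic) (x y : 'rV[F2]_4) :
  dform inj c (map_mx inj x) (map_mx inj y) = inj (dform id c x y).
Proof. by rewrite /dform !trilin_inj !rmorphD. Qed.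

Lemma Kbar_char2 : 2%:R = 0 :> Kbar.
Proof. by rewrite -(rmorph_nat inj) (_ : 2%:R = 0) ?rmorph0 //; apply/eqP. Qed.

Lemma KbarN (x : Kbar) : - x = x.
Proof.
by apply/eqP; rewrite eq_sym -addr_eq0 -mulr2n -mulr_natr Kbar_char2 mulr0.
Qed.

(** An Artin-Schreier equation: [g = 1] yields a generator of F_4, and [g = inj (F D)] splits the
    quadratic factor on a tangent plane. *)
Lemma Kbar_quadratic (g : Kbar) : exists w : Kbar, w ^+ 2 = g + w.
Proof.
have [w w2] := @GRing.solve_monicpoly Kbar 2 (fun i => if i == 0%N then g else 1) isT.
by exists w; rewrite w2 big_ord_recl big_ord1 /= expr0 expr1 mulr1 mul1r.
Qed.

(** * Lines, frames and spans *)

Section Pencil.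
Variables (K : fieldType) (n : nat).
Implicit Types x y : 'rV[K]_n.

Definition pencil x y : 'M[K]_(2, n) :=
  \matrix_(i < 2, j < n) (if i == 0 then x 0 j else y 0 j).

Lemma mul_pencil (v : 'rV[K]_2) x y :
  v *m pencil x y = v 0 0 *: x + v 0 1 *: y.
Proof.
by apply/rowP=> j; rewrite !mxE big_ord_recl big_ord1 !mxE /=;
   rewrite (_ : lift 0 0 = 1) //; apply: val_inj.
Qed.

Lemma sub_pencil z x y :
  (z <= pencil x y)%MS -> exists a b, z = a *: x + b *: y.
Proof. by case/submxP=> v ->; exists (v 0 0), (v 0 1); rewrite mul_pencil. Qed.

Lemma pencil_sub a b x y : ((a *: x + b *: y)%R <= pencil x y)%MS.
Proof.
apply/submxP; exists (\row_(i < 2) (if i == 0 then a else b)).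
by rewrite mul_pencil !mxE.
Qed.

Lemma pencil_subl x y : (x <= pencil x y)%MS.
Proof. by have := pencil_sub 1 0 x y; rewrite scale0r scale1r addr0. Qed.

Lemma pencil_subr x y : (y <= pencil x y)%MS.
Proof. by have := pencil_sub 0 1 x y; rewrite scale0r scale1r add0r. Qed.

Lemma rank_pencil x y :
  (forall a b, a *: x + b *: y = 0 -> a = 0 /\ b = 0) -> \rank (pencil x y) = 2%N.
Proof.
move=> free_xy; apply/eqP; change (row_free (pencil x y)).
apply: inj_row_free => v; rewrite mul_pencil => /free_xy [v0 v1].
apply/rowP=> i; rewrite mxE.
by case: (eqVneq i 0) => [->//|]; case: i => [[|[|//]] //= lti] _;
   rewrite -[RHS]v1; congr (v _ _); apply: val_inj.
Qed.

End Pencil.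

Lemma map_pencil (K K' : fieldType) n (f : {rmorphism K -> K'}) (x y : 'rV[K]_n) :
  map_mx f (pencil x y) = pencil (map_mx f x) (map_mx f y).
Proof. by apply/matrixP => i j; rewrite !mxE; case: ifP. Qed.

Lemma F2P (a : F2) : a = 0 \/ a = 1.
Proof. by case: a => [[|[|//]] lt_a]; [left|right]; apply: val_inj. Qed.

Lemma addrr_F2mod (V : lmodType F2) (x : V) : x + x = 0.
Proof. by rewrite -mulr2n -scaler_nat (_ : 2%:R = 0) ?scale0r //; apply/eqP. Qed.

Lemma delta_mx_neq0 n (i : 'I_n) : delta_mx 0 i != 0 :> 'rV[F2]_n.
Proof. by apply/eqP=> /rowP/(_ i)/eqP; rewrite !mxE !eqxx. Qed.

Lemma rank_pencil_F2 n (x y : 'rV[F2]_n) :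
  x != 0 -> y != 0 -> x != y -> \rank (pencil x y) = 2%N.
Proof.
move=> x0 y0 xy; apply: rank_pencil => a b.
case: (F2P a) => ->; case: (F2P b) => ->; rewrite ?scale0r ?scale1r ?add0r ?addr0.
- by [].
- by move/eqP; rewrite (negPf y0).
- by move/eqP; rewrite (negPf x0).
by move/eqP; rewrite addr_eq0 -[- y]addr0 -(addrr_F2mod y) addKr (negPf xy).
Qed.

Lemma pencil_rows (K : fieldType) n (L : 'M[K]_(2, n)) :
  L = pencil (row 0 L) (row 1 L).
Proof.
apply/matrixP=> i j; rewrite !mxE.
by case: (eqVneq i 0) => [->//|]; case: i => [[|[|//]] lti] //= _;
   congr (L _ _); apply: val_inj.
Qed.

Lemma frame_extension (K : fieldType) (L : 'M[K]_(2, 4)) :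
  \rank L = 2%N ->
  exists2 M : 'M[K]_4, M \in unitmx & row 0 M = row 0 L /\ row 1 M = row 1 L.
Proof.
move=> rL.
(* The complement has rank [4 - 2], so a row basis of it can be stacked under [L]. *)
have [N eqN] : exists N : 'M[K]_(2, 4), (N :=: L^C)%MS.
  have: exists N : 'M[K]_(\rank L^C%MS, 4), (N :=: L^C)%MS.
    by exists (row_base L^C%MS); exact: eq_row_base.
  by rewrite mxrank_compl rL.
exists (col_mx L N : 'M_4).
  rewrite -row_full_unit; have: row_full (col_mx L N : 'M_(2 + 2, 4)); last exact.
  rewrite /row_full -(addsmxE L N) (adds_eqmx (eqmx_refl L) eqN).
  exact: addsmx_compl_full.
split; apply/rowP=> j; rewrite !mxE.
  by case: splitP => [i /= i0|i //]; congr (L _ _); apply: val_inj.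
by case: splitP => [i /= i0|i //]; congr (L _ _); apply: val_inj.
Qed.

(* Locked, as are the points below: otherwise unification tries to match different
   combinations entrywise. *)
HB.lock Definition comb (K : fieldType) (M : 'M[K]_4) (a b c d : K) : 'rV[K]_4 :=
  a *: row 0 M + b *: row 1 M + c *: row 2%:R M + d *: row 3%:R M.

Lemma comb_sum (K : fieldType) (M : 'M[K]_4) a b c d :
  comb M a b c d = a *: row 0 M + b *: row 1 M + c *: row 2%:R M + d *: row 3%:R M.
Proof. by rewrite comb.unlock. Qed.

Section Frame.
Variables (K : fieldType) (M : 'M[K]_4).
Hypothesis unitM : M \in unitmx.
Local Notation comb := (comb M).

Lemma combE a b c d : comb a b c d = \row_(i < 4) [:: a; b; c; d]`_i *m M.
Proof.
rewrite mulmx_sum_row !big_ord_recl big_ord0 addr0 !addrA comb_sum !mxE /=.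
by do ![congr (_ + _)]; congr (_ *: row _ M); apply: val_inj.
Qed.

Lemma combD a b c d a' b' c' d' :
  comb (a + a') (b + b') (c + c') (d + d') = comb a b c d + comb a' b' c' d'.
Proof. by rewrite !comb_sum; apply/rowP=> j; rewrite !mxE; ring. Qed.

Lemma combZ k a b c d :
  k *: comb a b c d = comb (k * a) (k * b) (k * c) (k * d).
Proof. by rewrite !comb_sum !scalerDr !scalerA. Qed.

Lemma comb_eq0 a b c d :
  comb a b c d = 0 -> [/\ a = 0, b = 0, c = 0 & d = 0].
Proof.
rewrite combE => E.
have {}E : \row_(i < 4) [:: a; b; c; d]`_i = 0 :> 'rV[K]_4.
  by rewrite -(mulmxK unitM (\row_i _)) E mul0mx.
by split; [move/rowP/(_ 0): E | move/rowP/(_ 1): E | move/rowP/(_ 2%:R): E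
  | move/rowP/(_ 3%:R): E]; rewrite !mxE.
Qed.

Lemma comb_surj (x : 'rV[K]_4) : exists a b c d, x = comb a b c d.
Proof.
pose y := x *m invmx M; exists (y 0 0), (y 0 1), (y 0 2%:R), (y 0 3%:R).
rewrite combE -[LHS](mulmxKV unitM) -/y; congr (_ *m _).
apply/rowP=> i; rewrite [RHS]mxE; case: i => [[|[|[|[|//]]]] lti] /=;
by congr (y _ _); apply: val_inj.
Qed.

End Frame.

Section Geometry.
Variable c : cubic.
Local Notation F := (cform id c).
Local Notation dF := (dform id c).
Local Notation FK := (cform inj c).

Lemma kline_ptE (P Q : 'rV[F2]_4) s t :
  kline_pt (pencil P Q) s t = s *: map_mx inj P + t *: map_mx inj Q.
Proof. by rewrite /kline_pt map_pencil mul_pencil !mxE. Qed.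

(** Both ends lie on S, so only the mixed terms survive; the linear factor gives the residual
    intersection point. *)
Lemma FK_pencil (P Q : 'rV[F2]_4) s t :
  F P = 0 -> F Q = 0 ->
  FK (s *: map_mx inj P + t *: map_mx inj Q)
  = s * t * (inj (dF P Q) * s + inj (dF Q P) * t).
Proof.
by move=> P0 Q0; rewrite cform_pencil !cform_inj !dform_inj P0 Q0 rmorph0; ring.
Qed.

Lemma inter3_tangent (P R : 'rV[F2]_4) :
  P != 0 -> R != 0 -> P != R -> F P = 0 -> F R = 0 -> dF P R = 0 -> dF R P = 1 ->
  inter3 c (pencil P R) P P R.
Proof.
move=> P0 R0 PR FP FR d1 d2; split; first exact: rank_pencil_F2.
have E s t : Defs.FK c (kline_pt (pencil P R) s t) = s * t * t.
  by rewrite /Defs.FK kline_ptE FK_pencil // d1 d2 rmorph0 rmorph1; ring.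
split; first by move/(_ 1 1); rewrite E !mulr1; apply/eqP/oner_neq0.
exists (delta_mx 0 0), (delta_mx 0 0), (delta_mx 0 1).
split; first by split; exact: delta_mx_neq0.
split; first by rewrite !mul_pencil !mxE /= !scale0r !scale1r add0r addr0.
exists 1; split; first exact: oner_neq0.
by move=> s t; rewrite E /lform !mxE /= rmorph0 rmorph1; ring.
Qed.

Lemma inter3_secant (P R : 'rV[F2]_4) :
  P != 0 -> R != 0 -> P != R -> F P = 0 -> F R = 0 -> dF P R = 1 -> dF R P = 1 ->
  inter3 c (pencil P R) P (P + R) R.
Proof.
move=> P0 R0 PR FP FR d1 d2; split; first exact: rank_pencil_F2.
have E s t : Defs.FK c (kline_pt (pencil P R) s t) = s * t * (s + t).
  by rewrite /Defs.FK kline_ptE FK_pencil // d1 d2 rmorph1; ring.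
split.
  (* The form [s t (s + t)] vanishes at every F_2-point of the line, so it is evaluated at [(1 : w)]
     with [w] in F_4, where it equals [w^3]. *)
  move=> all0; have [w w2] := Kbar_quadratic 1.
  have /eqP := all0 1 w; rewrite E mul1r -w2 -exprS expf_eq0 /= => /eqP w0.
  by move/eqP: w2; rewrite w0 expr0n addr0 eq_sym oner_eq0.
exists (delta_mx 0 0), (const_mx 1), (delta_mx 0 1).
split.
  split; try exact: delta_mx_neq0.
  by apply/eqP=> /rowP/(_ 0)/eqP; rewrite !mxE.
split; first by rewrite !mul_pencil !mxE /= !scale0r !scale1r add0r addr0.
exists 1; split; first exact: oner_neq0.
move=> s t; rewrite E /lform !mxE /= rmorph0 rmorph1.
by rewrite !mul0r !mul1r sub0r subr0 !KbarN; ring.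
Qed.

Section Closure.
Variable P0 : 'rV[F2]_4.
Hypothesis SP0 : SK c P0.
Local Notation B := (fun X => X = P0).

(** Stage 0 is [B] itself, without a test of membership in S; there [SP0] answers. *)
Lemma Bn_SK n R : Bn c B n R -> SK c R.
Proof. by case: n => [->//|n] []. Qed.

Lemma Bn_mono m n R : (m <= n)%N -> Bn c B m R -> Bn c B n R.
Proof.
move/subnK <-; elim: (n - m)%N => // k IH /IH BR.
by rewrite addSn; split; [exact: Bn_SK BR | left].
Qed.

Lemma Span_SK R : Span c B R -> SK c R.
Proof. by case=> n /Bn_SK. Qed.

Lemma Span_inter3 L P Q R :
  Span c B P -> Span c B Q -> SK c R -> inter3 c L P Q R -> Span c B R.
Proof.
case=> m BP [n BQ] SR PQR; exists (maxn m n).+1; split=> //; right.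
by exists P, Q, L; split=> //; [apply: Bn_mono BP | apply: Bn_mono BQ];
  rewrite (leq_maxl, leq_maxr).
Qed.
End Closure.

End Geometry.

(** * Eckardt points and smoothness *)

Section Eckardt.
Variable c : cubic.
Local Notation F := (cform id c).
Local Notation dF := (dform id c).
Local Notation FK := (cform inj c).
Local Notation dFK := (dform inj c).

Lemma line_on_S_pencil (x y : 'rV[Kbar]_4) :
  (forall a b, a *: x + b *: y = 0 -> a = 0 /\ b = 0) ->
  FK x = 0 -> FK y = 0 -> dFK x y = 0 -> dFK y x = 0 ->
  line_on_S c (pencil x y).
Proof.
move=> free_xy Fx Fy dxy dyx; split; first exact: rank_pencil.
move=> z /sub_pencil [a [b ->]].
by rewrite /Defs.FK cform_pencil Fx Fy dxy dyx !mulr0 !addr0.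
Qed.

(* On the tangent plane at P, F(aP + bQ + dD) = d (b^2 + b d + F(D) d^2), whose second
   factor is a pair of distinct lines through P. *)
Lemma eckardt_of_plane (P Q D : 'rV[F2]_4) :
  (forall a b d : Kbar,
     a *: map_mx inj P + b *: map_mx inj Q + d *: map_mx inj D = 0 ->
     [/\ a = 0, b = 0 & d = 0]) ->
  F P = 0 -> F Q = 0 -> dF P Q = 0 -> dF Q P = 0 ->
  dF P D = 0 -> dF D P = 0 -> dF (D + Q) P = 0 -> dF D Q = 1 -> dF Q D = 1 ->
  eckardt c (map_mx inj P).
Proof.
set p := map_mx inj P; set q := map_mx inj Q; set d := map_mx inj D.
move=> free FP FQ PQ QP PD DP DQP DQ QD.
have [w w2] := Kbar_quadratic (inj (F D)).
(* The second factor vanishes at [b = r], [d = 1]. *)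
have lineX r : r ^+ 2 = inj (F D) + r -> line_on_S c (pencil p (d + r *: q)).
  move=> r2; apply: line_on_S_pencil.
  - move=> a b E; have [] // := free a (b * r) b.
    by rewrite -E; apply/rowP=> j; rewrite !mxE; ring.
  - by rewrite cform_inj FP rmorph0.
  - rewrite -[d]scale1r cform_pencil !cform_inj !dform_inj DQ QD FQ.
    rewrite r2 rmorph1 rmorph0.
    (* The left side is [F(D) + r + r^2]. *)
    transitivity (2%:R * (inj (F D) + r)); first by ring.
    by rewrite Kbar_char2 mul0r.
  - by rewrite dform_linearr !dform_inj PD PQ rmorph0 mulr0 addr0.
  (* Given the values at [D] and at [Q], the hypothesis on [D + Q] says that the cross term is
     zero. *)
  by rewrite dform_pencill /hessian -map_mxD !dform_inj DP QP DQP rmorph0; ring.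
have neq_pencil x y :
    (forall a b, x = a *: p + b *: y -> False) -> ~~ (pencil p x == pencil p y)%MS.
  move=> xPy; apply/negP=> /andP[sub _].
  by have [a [b]] := sub_pencil (submx_trans (pencil_subr p x) sub); apply: xPy.
split.
  apply/eqP=> p0; have [] := free 1 0 0; last by move/eqP; rewrite oner_eq0.
  by rewrite p0 !scale0r scaler0 !addr0.
split; first by rewrite /Defs.FK cform_inj FP rmorph0.
(* The linear factor [d] gives the first line, the roots [w] and [w + 1] of the quadratic factor the
   other two. *)
exists (pencil p q), (pencil p (d + w *: q)), (pencil p (d + (w + 1) *: q)).
split; rewrite ?pencil_subl //.
- apply: line_on_S_pencil; rewrite ?cform_inj ?dform_inj ?FP ?FQ ?PQ ?QP ?rmorph0 //.
  move=> a b E; have [] // := free a b 0.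
  by rewrite E scale0r addr0.
- exact: lineX.
- apply: lineX; rewrite sqrrD w2 expr1n mulr1 -mulr_natr Kbar_char2 mulr0 addr0.
  by rewrite addrA.
have far r : ~~ (pencil p q == pencil p (d + r *: q))%MS.
  apply: neq_pencil => a b E.
  have [] := free a (b * r - 1) b.
    transitivity (a *: p + b *: (d + r *: q) - q); last by rewrite -E subrr.
    by apply/rowP=> j; rewrite !mxE; ring.
  by move=> _ + b0; rewrite b0 mul0r sub0r => /eqP; rewrite oppr_eq0 oner_eq0.
split=> //.
apply: neq_pencil => a b E.
have [] := free a (b * (w + 1) - w) (b - 1).
  transitivity (a *: p + b *: (d + (w + 1) *: q) - (d + w *: q)).
    by apply/rowP=> j; rewrite !mxE; ring.
  by rewrite -E subrr.
move=> _ + /eqP; rewrite subr_eq0 => + /eqP b1.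
by rewrite b1 mul1r [w + 1]addrC addrK => /eqP; rewrite oner_eq0.
Qed.

End Eckardt.

(** On the line, F restricts to [s t (a s + b t)]. The F_2-point [t = 1] only gives [a = b]; the
    F_4-point [t = w] then excludes [a = b = 1]. *)
Lemma line_vanish (c : cubic) (P Q : 'rV[F2]_4) :
  line_on_S c (map_mx inj (pencil P Q)) ->
  [/\ cform id c P = 0, cform id c Q = 0, dform id c P Q = 0 & dform id c Q P = 0].
Proof.
case=> _ onS.
have vanish s t : cform inj c (s *: map_mx inj P + t *: map_mx inj Q) = 0.
  by apply: onS; rewrite map_pencil pencil_sub.
have FP : cform id c P = 0.
  apply: (fmorph_inj inj); have := vanish 1 0.
  by rewrite scale1r scale0r addr0 cform_inj rmorph0.
have FQ : cform id c Q = 0.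
  apply: (fmorph_inj inj); have := vanish 0 1.
  by rewrite scale1r scale0r add0r cform_inj rmorph0.
have [w w2] := Kbar_quadratic 1.
have w0 : w != 0.
  by apply: contra_eq_neq w2 => ->; rewrite expr0n addr0 eq_sym oner_eq0.
have vanish' t : t != 0 -> inj (dform id c P Q) + inj (dform id c Q P) * t = 0.
  move=> t0; have := vanish 1 t; rewrite FK_pencil // mul1r mulr1 => /eqP.
  by rewrite mulf_eq0 (negPf t0) => /eqP.
have := vanish' w w0; have := vanish' 1 (oner_neq0 _); rewrite mulr1.
case: (F2P (dform id c P Q)) => ->; case: (F2P (dform id c Q P)) => ->;
  rewrite !(rmorph0, rmorph1) ?add0r ?addr0 ?mul1r //.
- by move/eqP; rewrite oner_eq0.
- by move/eqP; rewrite oner_eq0.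
by move=> _; rewrite -w2 => /eqP; rewrite expf_eq0 (negPf w0).
Qed.

(** The partial derivatives are the values of [dform inj c x] at the standard basis. By linearity in
    the direction, any other basis detects whether they all vanish. *)
Lemma smooth_dform (c : cubic) (M : 'M[Kbar]_4) (x : 'rV[Kbar]_4) :
  smooth c -> M \in unitmx -> x != 0 -> cform inj c x = 0 ->
  exists i, dform inj c x (row i M) != 0.
Proof.
move=> smc uM x0 Fx; have [l dl] := smc x x0 Fx; apply/existsP.
apply: contraR dl; rewrite negb_exists => /forallP all0.
have -> : dcform inj c l x = dform inj c x (delta_mx 0 l).
  rewrite dformE (bigD1 l) //= !mxE !eqxx mul1r big1 ?addr0 // => i il.
  by rewrite mxE (negPf il) andbF mul0r.
have {}all0 i : dform inj c x (row i M) = 0.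
  by apply/eqP; rewrite -[_ == _]negbK all0.
have [a [b [e [d ->]]]] := comb_surj uM (delta_mx 0 l).
by rewrite comb_sum dform_combr !all0 !mulr0 !addr0.
Qed.

(** * Boolean coordinates over F_2 *)

Definition bit (a : F2) : bool := a != 0.

Lemma bitK a : (bit a)%:R = a.
Proof. by case: (F2P a) => ->. Qed.

Lemma natrK (b : bool) : bit b%:R = b.
Proof. by case: b. Qed.

Lemma bitD a b : bit (a + b) = bit a (+) bit b.
Proof. by case: (F2P a) => ->; case: (F2P b) => ->. Qed.

Lemma bitM a b : bit (a * b) = bit a && bit b.
Proof. by case: (F2P a) => ->; case: (F2P b) => ->. Qed.

Lemma bit_eq0 a : bit a = false -> a = 0.
Proof. by move/negbFE/eqP. Qed.

Lemma bit_eq1 a : bit a = true -> a = 1.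
Proof. by case: (F2P a) => ->. Qed.

(** Euler's relation with [3 = 1]. *)
Lemma cform_dform (c : cubic) x : cform id c x = dform id c x x.
Proof. by rewrite dform_diag; case: (F2P (cform id c x)) => ->; apply/eqP. Qed.

Definition vec := (bool * bool * bool * bool)%type.

Definition dot (x y : vec) : bool :=
  let: (x0, x1, x2, x3) := x in let: (y0, y1, y2, y3) := y in
  (x0 && y0) (+) (x1 && y1) (+) (x2 && y2) (+) (x3 && y3).

Definition vadd (x y : vec) : vec :=
  let: (x0, x1, x2, x3) := x in let: (y0, y1, y2, y3) := y in
  (x0 (+) y0, x1 (+) y1, x2 (+) y2, x3 (+) y3).

Definition is0 (x : vec) : bool :=
  let: (x0, x1, x2, x3) := x in ~~ [|| x0, x1, x2 | x3].

(** One bit per cubic monomial in four variables, except for the four monomials in the first two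
    variables alone, which vanish because S contains l. *)
Record coefs := Coefs {
  g02 : bool; g12 : bool; h012 : bool; g03 : bool; g13 : bool; h013 : bool;
  g20 : bool; g21 : bool; g22 : bool; g23 : bool;
  g30 : bool; g31 : bool; g32 : bool; g33 : bool; h023 : bool; h123 : bool }.

(** Entry [j] is dF at [x] in the direction e_j. Squares are dropped, as [b^2 = b] in F_2, and each
    [hijk] serves three entries by symmetry of the polarization. *)
Definition grad (k : coefs) (x : vec) : vec :=
  let: (x0, x1, x2, x3) := x in
  ((x2 && g20 k) (+) (x3 && g30 k) (+) (x1 && (x2 && h012 k))
    (+) (x1 && (x3 && h013 k)) (+) (x2 && (x3 && h023 k)),
   (x2 && g21 k) (+) (x3 && g31 k) (+) (x0 && (x2 && h012 k))
    (+) (x0 && (x3 && h013 k)) (+) (x2 && (x3 && h123 k)),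
   (x0 && g02 k) (+) (x1 && g12 k) (+) (x2 && g22 k) (+) (x3 && g32 k)
    (+) (x0 && (x1 && h012 k)) (+) (x0 && (x3 && h023 k)) (+) (x1 && (x3 && h123 k)),
   (x0 && g03 k) (+) (x1 && g13 k) (+) (x2 && g23 k) (+) (x3 && g33 k)
    (+) (x0 && (x1 && h013 k)) (+) (x0 && (x2 && h023 k)) (+) (x1 && (x2 && h123 k))).

HB.lock Definition point (M : 'M[F2]_4) (x : vec) : 'rV[F2]_4 :=
  let: (x0, x1, x2, x3) := x in comb M x0%:R x1%:R x2%:R x3%:R.

Lemma pointE M x0 x1 x2 x3 :
  point M (x0, x1, x2, x3) = comb M x0%:R x1%:R x2%:R x3%:R.
Proof. by rewrite point.unlock. Qed.

Section Coordinates.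
Variables (c : cubic) (M : 'M[F2]_4).
Local Notation F := (cform id c).
Local Notation dF := (dform id c).
Local Notation hess := (hessian id c).
Local Notation e0 := (row 0 M).
Local Notation e1 := (row 1 M).
Local Notation e2 := (row 2%:R M).
Local Notation e3 := (row 3%:R M).
Hypotheses (F0 : F e0 = 0) (F1 : F e1 = 0) (d01 : dF e0 e1 = 0) (d10 : dF e1 e0 = 0).

Local Notation point := (point M).

(* In [coefs], [gij] stands for dF at e_i in the direction e_j and [hijk] for the
   polarization of dF at e_i, e_j in the direction e_k. *)
Definition surface : coefs := Coefs
  (bit (dF e0 e2)) (bit (dF e1 e2)) (bit (hess e0 e1 e2))
  (bit (dF e0 e3)) (bit (dF e1 e3)) (bit (hess e0 e1 e3))
  (bit (dF e2 e0)) (bit (dF e2 e1)) (bit (dF e2 e2)) (bit (dF e2 e3))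
  (bit (dF e3 e0)) (bit (dF e3 e1)) (bit (dF e3 e2)) (bit (dF e3 e3))
  (bit (hess e0 e2 e3)) (bit (hess e1 e2 e3)).

Lemma dform_point x y : bit (dF (point x) (point y)) = dot (grad surface x) y.
Proof.
(* In characteristic 2 the polarization is alternating. *)
have hd u v : hess u v u = 0.
  by rewrite hessian_diag; case: (F2P (dF u v)) => ->; apply/eqP.
have hd' u v : hess v u u = 0 by rewrite hessianCl hd.
case: x => [[[x0 x1] x2] x3]; case: y => [[[y0 y1] y2] y3].
have sq (b : bool) : b%:R ^+ 2 = b%:R :> F2 by case: b; apply/eqP.
rewrite !pointE !comb_sum dform_combr !dform_combl !sq.
have hp u v w : hess v w u = hess u v w by rewrite hessianC hessianCl.
rewrite !hd !hd' (hp e0 e1 e2) (hp e0 e1 e3) (hp e0 e2 e3) (hp e1 e2 e3).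
rewrite (hessianC _ _ e0 e2 e1) (hessianC _ _ e0 e3 e1).
rewrite (hessianC _ _ e0 e3 e2) (hessianC _ _ e1 e3 e2).
rewrite -[dF e0 e0]cform_dform -[dF e1 e1]cform_dform F0 F1 d01 d10 /surface.
move: (dform id c) (hessian id c) => D H.
(* The Boolean side is lifted to F_2, so that both sides are bits of polynomials and [ring] compares
   them. *)
rewrite /dot /= -[in RHS](natrK x0) -[in RHS](natrK x1) -[in RHS](natrK x2).
rewrite -[in RHS](natrK x3) -[in RHS](natrK y0) -[in RHS](natrK y1).
rewrite -[in RHS](natrK y2) -[in RHS](natrK y3) -!(bitM, bitD).
by congr (bit _); ring.
Qed.

End Coordinates.

(** * The decision procedure *)

Definition v0 : vec := (true, false, false, false).
Definition v1 : vec := (false, true, false, false).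
Definition v01 : vec := (true, true, false, false).

Definition off_line : seq vec :=
  [seq (p.1.1, p.1.2, p.2.1, p.2.2) |
    p <- allpairs pair
           [:: (false, false); (true, false); (false, true); (true, true)]
           [:: (true, false); (false, true); (true, true)]].

Definition vecs : seq vec := [:: v0, v1, v01 & off_line].

Lemma mem_vecs x : ~~ is0 x -> x \in vecs.
Proof. by case: x => [[[[] []] []] []]. Qed.

Lemma grad_line k x y :
  x \in [:: v0; v1; v01] -> y \in [:: v0; v1; v01] -> dot (grad k x) y = false.
Proof.
by rewrite !inE => /or3P[]/eqP-> /or3P[]/eqP->; case: k => * /=; rewrite !andbF.
Qed.

(* The tests use [if] where [&&] would do, because [vm_compute] evaluates both
   arguments of a function. *)
Section Decision.
Variable k : coefs.

(** The bit [dot d x] is F at [x], so points off S pass. *)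
Definition smooth_at (x : vec) : bool :=
  let d := grad k x in if dot d x then true else ~~ is0 d.

(** The test for singularity at the conjugate pair of F_4-points of l. *)
Definition gauss_constant : bool :=
  is0 (vadd (grad k v0) (grad k v1)) && is0 (vadd (grad k v0) (grad k v01)).

(** These are the hypotheses of [eckardt_of_plane] that involve [D]; those on [P] and [Q] alone hold
    because l lies on S. *)
Definition eckardt_plane (p q d : vec) : bool :=
  let gd := grad k d in
  if dot gd p then false else if dot gd q then
    [&& ~~ dot (grad k p) d, dot (grad k q) d & ~~ dot (grad k (vadd d q)) p]
  else false.

(* A pair is a vector together with its gradient, which is computed only once. *)
Definition adjoins (s : seq (vec * vec)) (r : vec * vec) : bool :=
  has (fun p => if dot r.2 p.1 then
    if dot p.2 r.1 then has (fun q => is0 (vadd (vadd p.1 r.1) q.1)) s else true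
    else false) s.

(** [n] is fuel; a round moves into [s] every point that a single line adjoins to it. *)
Fixpoint spans n (s rest : seq (vec * vec)) : bool :=
  if rest is [::] then true else if n is n'.+1 then
    spans n' (filter (adjoins s) rest ++ s) (filter (predC (adjoins s)) rest)
  else false.

Definition with_grad (x : vec) := (x, grad k x).

Definition spans_from (p : vec) : bool :=
  (* There are 15 points in P^3(F_2), and a round that changes anything absorbs at least one, so the
     fuel never cuts the search short. The starting point is itself in [rest] and must be reached
     again. *)
  spans 15 [:: with_grad p]
    (map with_grad (filter (fun x => ~~ dot (grad k x) x) vecs)).

(** A surface that violates a hypothesis passes at once; only the others reach the span
    computation. *)
Definition good : bool :=
  if gauss_constant then true else
  if all smooth_at vecs then
    if has (fun d => [|| eckardt_plane v0 v1 d, eckardt_plane v1 v0 d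
                       | eckardt_plane v01 v0 d]) off_line then true
    else spans_from v0 || spans_from v1
  else true.

End Decision.

Definition forallb (p : bool -> bool) := if p true then p false else false.

Lemma forallbP p : forallb p -> forall b, p b.
Proof. by rewrite /forallb; case: ifP => // pt pf []. Qed.

(** A single evaluation over all bit patterns, carried out by the kernel at [Qed]. *)
Lemma all_good :
  forallb (fun a1 => forallb (fun a2 => forallb (fun a3 => forallb (fun a4 =>
  forallb (fun b1 => forallb (fun b2 => forallb (fun b3 => forallb (fun b4 =>
  forallb (fun c1 => forallb (fun c2 => forallb (fun c3 => forallb (fun c4 =>
  forallb (fun d1 => forallb (fun d2 => forallb (fun d3 => forallb (fun d4 =>
    good (Coefs a1 a2 a3 a4 b1 b2 b3 b4 c1 c2 c3 c4 d1 d2 d3 d4))))))))))))))))).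
Proof. vm_cast_no_check (erefl true). Qed.

Lemma goodT k : good k.
Proof.
case: k => a1 a2 a3 a4 b1 b2 b3 b4 c1 c2 c3 c4 d1 d2 d3 d4.
have /forallbP/(_ a1)/forallbP/(_ a2)/forallbP/(_ a3)/forallbP/(_ a4) := all_good.
move=> /forallbP/(_ b1)/forallbP/(_ b2)/forallbP/(_ b3)/forallbP/(_ b4).
move=> /forallbP/(_ c1)/forallbP/(_ c2)/forallbP/(_ c3)/forallbP/(_ c4).
move=> /forallbP/(_ d1)/forallbP/(_ d2)/forallbP/(_ d3)/forallbP/(_ d4).
exact.
Qed.

(** * Soundness of the decision procedure *)

Lemma is0P x : reflect (x = (false, false, false, false)) (is0 x).
Proof. by case: x => [[[[] []] []] []]; constructor. Qed.

Lemma vadd_eq0 x y : is0 (vadd x y) -> x = y.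
Proof. by case: x y => [[[[] []] []] []] [[[[] []] []] []]. Qed.

Section Soundness.
Variables (c : cubic) (M : 'M[F2]_4).
Hypothesis unitM : M \in unitmx.
Local Notation F := (cform id c).
Local Notation dF := (dform id c).
Local Notation pt := (point M).
Hypothesis line_onS : line_on_S c (map_mx inj (pencil (row 0 M) (row 1 M))).
Local Notation k := (surface c M).

Lemma dform_pt x y : bit (dF (pt x) (pt y)) = dot (grad k x) y.
Proof. by have [*] := line_vanish line_onS; exact: dform_point. Qed.

Lemma cform_pt x : bit (F (pt x)) = dot (grad k x) x.
Proof. by rewrite cform_dform dform_pt. Qed.

Lemma point_add x y : pt (vadd x y) = pt x + pt y.
Proof.
case: x => [[[x0 x1] x2] x3]; case: y => [[[y0 y1] y2] y3].
have nD (a b : bool) : (a (+) b)%:R = a%:R + b%:R :> F2.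
  by case: a; case: b; apply/eqP.
by rewrite !pointE !nD combD.
Qed.

Lemma point_eq0 x : (pt x == 0) = is0 x.
Proof.
apply/eqP/is0P => [|->]; last by rewrite !pointE !comb_sum !scale0r !addr0.
case: x => [[[x0 x1] x2] x3]; rewrite pointE => /(comb_eq0 unitM) [].
by case: x0 => //; case: x1 => //; case: x2 => //; case: x3.
Qed.

Lemma point_surj P : exists x, P = pt x.
Proof.
have [a [b [d [e ->]]]] := comb_surj unitM P.
by exists (bit a, bit b, bit d, bit e); rewrite pointE !bitK.
Qed.

Lemma map_point x0 x1 x2 x3 :
  map_mx inj (pt (x0, x1, x2, x3)) = comb (map_mx inj M) x0%:R x1%:R x2%:R x3%:R.
Proof.
rewrite !pointE !comb_sum !map_mxD (map_mxZ _ x0%:R) (map_mxZ _ x1%:R).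
by rewrite (map_mxZ _ x2%:R) (map_mxZ _ x3%:R) !map_row !rmorph_nat.
Qed.

Lemma row_map_point i : exists y, row i (map_mx inj M) = map_mx inj (pt y).
Proof. by rewrite -map_row; have [y ->] := point_surj (row i M); exists y. Qed.

Lemma unit_mapM : map_mx inj M \in unitmx.
Proof. by rewrite map_unitmx. Qed.

(** The scalars are in [Kbar], where the frame stays invertible. The last two coordinates of [d] are
    not both zero and those of [p], [q] are, which forces [e = 0]; the first two coordinates then
    give [a] and [b]. *)
Lemma point_free p q d a b e :
  (p, q) \in [:: (v0, v1); (v1, v0); (v01, v0)] -> d \in off_line ->
  a *: map_mx inj (pt p) + b *: map_mx inj (pt q) + e *: map_mx inj (pt d) = 0 ->
  [/\ a = 0, b = 0 & e = 0].
Proof.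
move=> pq; case: d => [[[d0 d1] d2] d3] off.
have {off} : d2 || d3 by move: off; case: d0 d1 d2 d3 => [] [] [] [].
case: p pq => [[[p0 p1] p2] p3]; case: q => [[[q0 q1] q2] q3] pq d23.
have -> : a *: map_mx inj (pt (p0, p1, p2, p3))
    + b *: map_mx inj (pt (q0, q1, q2, q3)) + e *: map_mx inj (pt (d0, d1, d2, d3))
  = comb (map_mx inj M) (a * p0%:R + b * q0%:R + e * d0%:R)
      (a * p1%:R + b * q1%:R + e * d1%:R) (a * p2%:R + b * q2%:R + e * d2%:R)
      (a * p3%:R + b * q3%:R + e * d3%:R).
  rewrite (map_point p0) (map_point q0) (map_point d0).
  by rewrite (combZ _ a) (combZ _ b) (combZ _ e) !combD.
case/(comb_eq0 unit_mapM); move: pq; rewrite !inE !xpair_eqE.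
by case/or3P=> /andP[/andP[/andP[/andP[/eqP-> /eqP->] /eqP->] /eqP->]
   /andP[/andP[/andP[/eqP-> /eqP->] /eqP->] /eqP->]];
  rewrite !(mulr0, mulr1, add0r, addr0) => E0 E1 E2 E3;
  (have e0 : e = 0
     by move: d23 E2 E3; case: d2 => //=; [|case: d3 => //]; rewrite mulr1);
  move: E0 E1; rewrite e0 !mul0r !addr0 => E0 E1; split=> //;
  move: E0; rewrite E1 ?add0r.
Qed.

(** A zero [grad] kills every F_2-direction, in particular the rows of the frame, which
    [smooth_dform] forbids. *)
Lemma smooth_surface : smooth c -> all (smooth_at k) vecs.
Proof.
move=> smc; apply/allP => x xV.
have x0 : pt x != 0.
  by rewrite point_eq0; move: x xV; apply/allP.
rewrite /smooth_at -cform_pt; case: ifP => // /bit_eq0 Fx.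
have [||i] := @smooth_dform c (map_mx inj M) (map_mx inj (pt x)) smc unit_mapM.
- by rewrite map_mx_eq0.
- by rewrite cform_inj Fx rmorph0.
apply: contra => /is0P g0.
have d0 y : dF (pt x) (pt y) = 0.
  by apply: bit_eq0; rewrite dform_pt g0; case: y => [[[? ?] ?] ?].
have [y ->] := row_map_point i.
by rewrite dform_inj d0 rmorph0.
Qed.

(* If the Gauss map is constant on l(F_2), then it is constant on l up to the factor
   1 + w + w^2, which vanishes at w in F_4. *)
Lemma gauss_not_constant : smooth c -> ~~ gauss_constant k.
Proof.
move=> smc; apply/negP => /andP[/vadd_eq0 g1 /vadd_eq0 g2].
have [FP FQ PQ QP] := line_vanish line_onS.
have P0 : row 0 M = pt v0.
  by rewrite /v0 pointE comb_sum mulr1n !mulr0n scale1r !scale0r !addr0.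
have Q0 : row 1 M = pt v1.
  by rewrite /v1 pointE comb_sum mulr1n !mulr0n scale1r !scale0r !addr0 add0r.
have [w w2] := Kbar_quadratic 1.
pose x := map_mx inj (pt v0) + w *: map_mx inj (pt v1).
have x0 : x != 0.
  apply/eqP; rewrite /x (map_point true) (map_point false) combZ -combD.
  case/(comb_eq0 unit_mapM) => /eqP.
  by rewrite mulr0 addr0 mulr1n oner_eq0.
have Fx : cform inj c x = 0.
  rewrite /x -[map_mx inj _]scale1r FK_pencil -?P0 -?Q0 // PQ QP rmorph0.
  by rewrite !mul0r addr0 mulr0.
have [i] := smooth_dform smc unit_mapM x0 Fx; apply/negP; rewrite negbK.
have [y ->] := row_map_point i.
have eqd u v : grad k u = grad k v -> dF (pt u) (pt y) = dF (pt v) (pt y).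
  by move=> E; rewrite -(bitK (dF _ _)) -[RHS]bitK !dform_pt E.
rewrite /x dform_pencill /hessian -map_mxD -point_add !dform_inj.
rewrite -(eqd v0 v1) // -(eqd v0 v01) // w2.
apply/eqP; set d := inj _; transitivity (2%:R * d); first by ring.
by rewrite Kbar_char2 mul0r.
Qed.

Lemma eckardt_surface p q d :
  (p, q) \in [:: (v0, v1); (v1, v0); (v01, v0)] -> d \in off_line ->
  eckardt_plane k p q d -> eckardt c (map_mx inj (pt p)).
Proof.
move=> pq off; rewrite /eckardt_plane -!dform_pt point_add.
case: ifP => // /bit_eq0 DP; case: ifP => // /bit_eq1 DQ.
case/and3P=> /negbTE/bit_eq0 PD /bit_eq1 QD /negbTE/bit_eq0 DQP.
have [pl ql] : p \in [:: v0; v1; v01] /\ q \in [:: v0; v1; v01].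
  by move: pq; rewrite !inE => /or3P[] /eqP[-> ->].
have dF_line x y : x \in [:: v0; v1; v01] -> y \in [:: v0; v1; v01] ->
    dF (pt x) (pt y) = 0.
  by move=> xl yl; apply: bit_eq0; rewrite dform_pt grad_line.
have F_line x : x \in [:: v0; v1; v01] -> F (pt x) = 0.
  by move=> xl; rewrite cform_dform dF_line.
exact: (eckardt_of_plane (fun a b e => point_free (a := a) (b := b) (e := e) pq off)
  (F_line _ pl) (F_line _ ql) (dF_line _ _ pl ql) (dF_line _ _ ql pl)
  PD DP DQP DQ QD).
Qed.

Section Spanning.
Variable p0 : vec.
Hypothesis p0_SK : SK c (pt p0).
Local Notation Sp := (Span c (fun X => X = pt p0)).

(** With [dF_R(P) = 1], the value of [dF_P(R)] decides between the tangent at P, which needs only P,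
    and the secant, which also needs [P + R] in the span. *)
Lemma adjoins_sound s r :
  (forall p, p \in s -> p.2 = grad k p.1 /\ Sp (pt p.1)) ->
  SK c (pt r.1) -> r.2 = grad k r.1 -> adjoins s r -> Sp (pt r.1).
Proof.
move=> s_ok Sr gr /hasP [p /s_ok[gp Sp_p]]; rewrite gr gp -!dform_pt.
case: ifP => // /bit_eq1 rp.
have [p_nz Fp] := Span_SK p0_SK Sp_p; have [r_nz Fr] := Sr.
case: ifP => [/bit_eq1 pr /hasP[q /s_ok[_ Sq]] | /bit_eq0 pr _].
  move/vadd_eq0=> pqr.
  have eq_q : pt q.1 = pt p.1 + pt r.1 by rewrite -point_add pqr.
  rewrite eq_q in Sq; apply: (Span_inter3 p0_SK Sp_p Sq) => //.
  (* If P = R, then [P + R] would be zero, hence not a point of S. *)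
  apply: inter3_secant => //; apply/eqP=> eq_pr.
  by have [/eqP[]] := Span_SK p0_SK Sq; rewrite eq_pr addrr_F2mod.
apply: (Span_inter3 p0_SK Sp_p Sp_p) => //.
(* If P = R, then [dF_R(P)] would be [F(P) = 0]. *)
apply: inter3_tangent => //; apply: contra_eq_neq rp => <-.
by rewrite -cform_dform Fp eq_sym oner_neq0.
Qed.

(** Induction on the fuel. The invariant also carries the cached gradients, so that [adjoins_sound]
    applies in each round. *)
Lemma spans_sound n s rest :
  (forall p, p \in s -> p.2 = grad k p.1 /\ Sp (pt p.1)) ->
  (forall r, r \in rest -> r.2 = grad k r.1 /\ SK c (pt r.1)) ->
  spans n s rest -> forall r, r \in rest -> Sp (pt r.1).
Proof.
elim: n s rest => [|n IH] s [|r0 rest'] // s_ok.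
set rest := r0 :: rest' => rest_ok sp r r_rest.
have {}sp : spans n (filter (adjoins s) rest ++ s) (filter (predC (adjoins s)) rest).
  exact: sp.
have new_ok p : p \in filter (adjoins s) rest -> p.2 = grad k p.1 /\ Sp (pt p.1).
  rewrite mem_filter => /andP[adj /rest_ok[gp Sp_p]]; split=> //.
  exact: adjoins_sound adj.
have [adj|nadj] := boolP (adjoins s r).
  by case: (new_ok r); rewrite ?mem_filter ?adj.
apply: (IH _ _ _ _ sp); last by rewrite mem_filter /= nadj.
  by move=> p; rewrite mem_cat => /orP[/new_ok|/s_ok].
by move=> p; rewrite mem_filter => /andP[_ /rest_ok].
Qed.

Lemma spans_from_sound : spans_from k p0 -> forall R, SK c R -> Sp R.
Proof.
rewrite /spans_from => sp R SR; have [x xR] := point_surj R; rewrite xR in SR *.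
have vecs_nz y : y \in vecs -> ~~ is0 y by move: y; apply/allP.
have [x0 Fx] := SR; rewrite point_eq0 in x0.
apply: (spans_sound _ _ sp (r := with_grad k x)).
- by move=> p; rewrite inE => /eqP->; split=> //; exists 0%N.
- move=> r /mapP[y]; rewrite mem_filter -cform_pt => /andP[/negbTE/bit_eq0 Fy yV] ->.
  by split; [|split; [rewrite point_eq0 vecs_nz|]].
by rewrite map_f // mem_filter -cform_pt Fx mem_vecs.
Qed.

End Spanning.
End Soundness.

Theorem theorem3 (c : cubic) (L : 'M['F_2]_(2, 4)) :
  smooth c ->
  line_on_S c (map_mx inj L) ->
  (forall R : 'rV['F_2]_4, on_kline L R -> ~ eckardt c (map_mx inj R)) ->
  exists P : 'rV['F_2]_4,
    on_kline L P /\ (forall R : 'rV['F_2]_4, SK c R <-> Span c (fun X => X = P) R).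
Proof.
move=> smc lineL noE; have [rL onS] := lineL.
rewrite mxrank_map in rL; have [M unitM [M0 M1]] := frame_extension rL.
(* The frame is adapted to l, so [v0], [v1] and [v01] are its three F_2-points. *)
have eqL : L = pencil (row 0 M) (row 1 M) by rewrite M0 M1 -pencil_rows.
rewrite eqL in lineL noE *.
have pt_on p : p \in [:: v0; v1; v01] ->
    on_kline (pencil (row 0 M) (row 1 M)) (point M p).
  move=> pl; split.
    by rewrite point_eq0 //; move: p pl; apply/allP.
  have [a [b ->]] : exists a b, point M p = a *: row 0 M + b *: row 1 M.
    move: pl; case: p => [[[p0 p1] p2] p3] pl; exists p0%:R, p1%:R.
    have [-> ->] : p2 = false /\ p3 = false.
      by move: pl; case: p0 p1 p2 p3 => [] [] [] [].
    by rewrite !pointE !comb_sum !scale0r !addr0.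
  exact: pencil_sub.
have := goodT (surface c M).
(* Smoothness settles the first two tests and the Eckardt hypothesis the third, which leaves the
   span from [v0] or [v1]. *)
rewrite /good (negbTE (gauss_not_constant unitM lineL smc)).
rewrite (smooth_surface unitM lineL smc).
case: ifP => [/hasP[d off]|_ spans].
  have noP p q : (p, q) \in [:: (v0, v1); (v1, v0); (v01, v0)] ->
      p \in [:: v0; v1; v01] -> eckardt_plane (surface c M) p q d = false.
    move=> pq pl; apply/negP => /(eckardt_surface unitM lineL pq off).
    exact: noE (pt_on p pl).
  by rewrite !noP.
have [p pl sp] : exists2 p, p \in [:: v0; v1] & spans_from (surface c M) p.
  by case/orP: spans => sp; [exists v0 | exists v1].
have pl' : p \in [:: v0; v1; v01].
  by move: pl; rewrite !inE => /orP[] ->; rewrite ?orbT.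
have Sp : SK c (point M p).
  have [p0 pL] := pt_on p pl'; split=> //.
  apply: (fmorph_inj inj); rewrite rmorph0 -cform_inj.
  by have [_] := lineL; apply; rewrite map_submx.
exists (point M p); split; first exact: pt_on.
move=> R; split; last exact: Span_SK.
exact: spans_from_sound.
Qed.
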